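(* The linearized aided INS with a single plane feature $\boldsymbol\Pi$ in the state vector has at least 7 unobservable directions, given by the columns of $$\mathbf N_{\pi}=\begin{bmatrix}\mathbf N_g&\mathbf 0_{12\times3}&\mathbf N_{123}\\-\lfloor\mathbf P_1\times\rfloor\mathbf g&\mathbf R_\Pi&\mathbf 0_3\\-\lfloor\boldsymbol\Pi\times\rfloor\mathbf g&\mathbf n_\pi\mathbf e_3^\top&\mathbf 0_3\end{bmatrix}.$$ That is, the 7 columns of $\mathbf N_\pi$ are linearly independent and $\mathbf M\mathbf N_\pi=\mathbf 0$, where $\mathbf M$ is the observability matrix.
   Context: $\lfloor\mathbf a\times\rfloor$ is the skew-symmetric matrix with $\lfloor\mathbf a\times\rfloor\mathbf b=\mathbf a\times\mathbf b$; $\mathbf e_i$ is the $i$-th standard basis vector of $\mathbb R^3$. All quantities below are evaluated at linearization points (state estimates); the same state variable always uses the same linearization point. At time steps $k=1,2,\dots$ (times $t_k$, $\delta t_k=t_k-t_1$), $\mathbf R_k\in SO(3)$ is the rotation from the global frame to the IMU/sensor frame, $\mathbf P_k,\mathbf V_k\in\mathbb R^3$ are IMU position and velocity in the global frame; $\mathbf g=(0,0,-g)^\top$, $g>0$, is gravity. For a continuous time $\tau$, $\mathbf R(\tau)$ and $\mathbf a(\tau)$ denote IMU orientation and IMU-frame linear acceleration. Error state ordering: (orientation error $\delta\boldsymbol\theta$, gyro bias, velocity, accelerometer bias, position, feature error); the first five blocks are 3-dimensional and the feature block has dimension $m$. State transition matrix: $$\boldsymbol\Phi_{(k,1)}=\begin{bmatrix}\Phi_{11}&\Phi_{12}&0&0&0&0\\0&\mathbf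 I_3&0&0&0&0\\\Phi_{31}&\Phi_{32}&\mathbf I_3&\Phi_{34}&0&0\\0&0&0&\mathbf I_3&0&0\\\Phi_{51}&\Phi_{52}&\Phi_{53}&\Phi_{54}&\mathbf I_3&0\\0&0&0&0&0&\mathbf I_m\end{bmatrix},$$ $\Phi_{11}=\mathbf R_k\mathbf R_1^\top$, $\Phi_{31}=-\lfloor(\mathbf V_k-\mathbf V_1+\mathbf g\,\delta t_k)\times\rfloor\mathbf R_1^\top$, $\Phi_{51}=\lfloor(\mathbf P_1+\mathbf V_1\delta t_k-\tfrac12\mathbf g\,\delta t_k^2-\mathbf P_k)\times\rfloor\mathbf R_1^\top$, $\Phi_{53}=\mathbf I_3\delta t_k$, $\Phi_{12}=-\int_{t_1}^{t_k}\mathbf R_k\mathbf R(\tau)^\top d\tau$, $\Phi_{32}=\int_{t_1}^{t_k}\mathbf R(s)^\top\lfloor\mathbf a(s)\times\rfloor\int_{t_1}^{s}\mathbf R(s)\mathbf R(\tau)^\top d\tau\,ds$, $\Phi_{52}=\int_{t_1}^{t_k}\int_{t_1}^{\theta}\mathbf R(s)^\top\lfloor\mathbf a(s)\times\rfloor\int_{t_1}^{s}\mathbf R(s)\mathbf R(\tau)^\top d\tau\,ds\,d\theta$, $\Phi_{34}=-\int_{t_1}^{t_k}\mathbf R(\tau)^\top d\tau$, $\Phi_{54}=-\int_{t_1}^{t_k}\int_{t_1}^{s}\mathbf R(\tau)^\top d\tau\,ds$. Plane feature. The plane is represented by its closest point to the origin, $\boldsymbol\Pi=d\,\mathbf n_\pi\in\mathbb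 R^3$ (global frame, $m=3$), with unit normal $\mathbf n_\pi$ and distance $d\neq0$. The direct plane measurement is the closest point in the sensor frame, $(d-\mathbf n_\pi^\top\mathbf P_k)\mathbf R_k\mathbf n_\pi$, with Jacobian $$\mathbf H_k=\mathbf R_k\begin{bmatrix}\mathbf H_{\pi1}&\mathbf 0_{3\times9}&-\mathbf n_\pi\mathbf n_\pi^\top&\mathbf H_{\pi2}\end{bmatrix},$$ $\mathbf H_{\pi1}=(d-\mathbf n_\pi^\top\mathbf P_k)\lfloor\mathbf n_\pi\times\rfloor\mathbf R_k^\top$, $\mathbf H_{\pi2}=\frac1d\left[(d-\mathbf n_\pi^\top\mathbf P_k)\mathbf I_3-\mathbf n_\pi\mathbf P_k^\top+2(\mathbf n_\pi^\top\mathbf P_k)\mathbf n_\pi\mathbf n_\pi^\top\right]$. The observability matrix $\mathbf M$ stacks $\mathbf H_k\boldsymbol\Phi_{(k,1)}$ over $k=1,2,\dots$; unobservable directions are vectors of its right null space. $\mathbf n_1^\perp,\mathbf n_2^\perp$ are unit vectors orthogonal to each other and to $\mathbf n_\pi$; $\mathbf R_\Pi=[\mathbf n_1^\perp\ \ \mathbf n_2^\perp\ \ \mathbf n_\pi]$ (a rotation matrix); $\mathbf N_g=\begin{bmatrix}(\mathbf R_1\mathbf g)^\top&\mathbf 0_{1\times3}&-(\lfloor\mathbf V_1\times\rfloor\mathbf g)^\top&\mathbf 0_{1\times3}\end{bmatrix}^\top\in\mathbb R^{12}$; $\mathbf N_{123}=\begin{bmatrix}\mathbf 0_{3\times1}&\mathbf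 0_{3\times1}&\mathbf R_1\mathbf n_\pi\\\mathbf 0_{3\times1}&\mathbf 0_{3\times1}&\mathbf 0_{3\times1}\\\mathbf n_1^\perp&\mathbf n_2^\perp&\mathbf 0_{3\times1}\\\mathbf 0_{3\times1}&\mathbf 0_{3\times1}&\mathbf 0_{3\times1}\end{bmatrix}\in\mathbb R^{12\times3}$.
   Formalization: Linear independence of the 7 columns is asserted only when the plane normal is not parallel to gravity; for a horizontal plane the first column is a combination of the others and the rank is 6. M N_π = 0 is asserted without this condition. *)

(* Defs.v *)
From HB Require Import structures.
From mathcomp Require Import all_boot all_order all_algebra.
From mathcomp Require Import all_classical all_reals all_analysis.
From mathcomp Require Import ring.

Set Implicit Arguments.
Unset Strict Implicit.
Unset Printing Implicit Defensive.

Import Order.TTheory GRing.Theory Num.Theory.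

Local Open Scope classical_set_scope.
Local Open Scope ring_scope.

Section LinearAlgebra.
Variable R : realType.

Definition dotv (u v : 'cV[R]_3) : R := (u^T *m v) 0 0.

(* Indices are taken in Z/3, so that i, i + 1, i + 2 is a cyclic permutation
   of the three coordinates. *)
Definition crossv (u v : 'cV[R]_3) : 'cV[R]_3 :=
  \col_(i < 3) (u (i + 1) 0 * v (i + 2%:R) 0 - u (i + 2%:R) 0 * v (i + 1) 0).

(* The j-th column of cross_mx a is a \times e_j. *)
Definition cross_mx (a : 'cV[R]_3) : 'M[R]_3 :=
  \matrix_(i < 3, j < 3) crossv a (delta_mx j 0) i 0.

Lemma cross_mxE (a b : 'cV[R]_3) : cross_mx a *m b = crossv a b.
Proof.
apply/matrixP => i j; rewrite (ord1 j) !mxE !big_ord_recr big_ord0 /= !mxE.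
pose f k := a (inord k) 0; pose h k := b (inord k) 0.
have aE l : a l 0 = f l by rewrite /f inord_val.
have bE l : b l 0 = h l by rewrite /h inord_val.
rewrite !{}aE !{}bE.
have m1 : (1 %% 3 = 1)%N by [].
have m2 : (2 %% 3 = 2)%N by [].
have m4 : ((2 + 2) %% 3 = 1)%N by [].
case: i => -[|[|[|//]]] ? /=; rewrite !(m1, m2, m4, add0n, modnn) /=; ring.
Qed.

Lemma cross_mx_antisym (a : 'cV[R]_3) : (cross_mx a)^T = - cross_mx a.
Proof.
pose f k := a (inord k) 0.
have aE l : a l 0 = f l by rewrite /f inord_val.
apply/matrixP => i j; rewrite !mxE !aE opprB.
case: i => -[|[|[|//]]] ?; case: j => -[|[|[|//]]] ? /=; ring.
Qed.

Definition is_SO3 (A : 'M[R]_3) : Prop := A *m A^T = 1%:M /\ \det A = 1.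

Definition mx_integral m n (a b : R) (F : R -> 'M[R]_(m, n)) : 'M[R]_(m, n) :=
  \matrix_(i, j) \int[lebesgue_measure]_(x in `[a, b]) F x i j.

(* Block dimensions are left-associated, 3 + 3 + 3 + 3 + 3 + m, as are the
   nested row_mx and col_mx below. *)
Definition row6 p n1 n2 n3 n4 n5 n6
    (A1 : 'M[R]_(p, n1)) (A2 : 'M[R]_(p, n2)) (A3 : 'M[R]_(p, n3))
    (A4 : 'M[R]_(p, n4)) (A5 : 'M[R]_(p, n5)) (A6 : 'M[R]_(p, n6)) :
    'M[R]_(p, n1 + n2 + n3 + n4 + n5 + n6) :=
  row_mx (row_mx (row_mx (row_mx (row_mx A1 A2) A3) A4) A5) A6.

Definition col4 n m1 m2 m3 m4
    (A1 : 'M[R]_(m1, n)) (A2 : 'M[R]_(m2, n)) (A3 : 'M[R]_(m3, n))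
    (A4 : 'M[R]_(m4, n)) : 'M[R]_(m1 + m2 + m3 + m4, n) :=
  col_mx (col_mx (col_mx A1 A2) A3) A4.

Definition col6 n m1 m2 m3 m4 m5 m6
    (A1 : 'M[R]_(m1, n)) (A2 : 'M[R]_(m2, n)) (A3 : 'M[R]_(m3, n))
    (A4 : 'M[R]_(m4, n)) (A5 : 'M[R]_(m5, n)) (A6 : 'M[R]_(m6, n)) :
    'M[R]_(m1 + m2 + m3 + m4 + m5 + m6, n) :=
  col_mx (col_mx (col4 A1 A2 A3 A4) A5) A6.

End LinearAlgebra.

(* The linearization points of the inertial system.  Time steps are
   k = 1, 2, ...; the values at k = 0 are never used. *)
Record linearization (R : realType) := Linearization {
  step_time : nat -> R;
  orient : R -> 'M[R]_3;  (* global-to-IMU rotation, as a function of time *)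
  accel : R -> 'cV[R]_3;  (* acceleration in the IMU frame *)
  position : nat -> 'cV[R]_3;  (* IMU position at step k, global frame *)
  velocity : nat -> 'cV[R]_3;  (* IMU velocity at step k, global frame *)
  grav : R                (* magnitude of gravity *)
}.

Section StateTransition.
Variables (R : realType) (L : linearization R).

Local Notation t := (step_time L).
Local Notation Rt := (orient L).
Local Notation a := (accel L).
Local Notation P := (position L).
Local Notation V := (velocity L).

Definition elapsed (k : nat) : R := t k - t 1%N.
Definition orient_at (k : nat) : 'M[R]_3 := Rt (t k).
Definition gvec : 'cV[R]_3 := - grav L *: delta_mx (2%:R : 'I_3) 0.

Local Notation g := gvec.
Local Notation dt := elapsed.

Definition Phi11 k : 'M[R]_3 := orient_at k *m (orient_at 1)^T.

Definition Phi12 k : 'M[R]_3 :=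
  - mx_integral (t 1%N) (t k) (fun tau => orient_at k *m (Rt tau)^T).

Definition Phi31 k : 'M[R]_3 :=
  - (cross_mx (V k - V 1%N + dt k *: g) *m (orient_at 1)^T).

(* the integrand in s that Phi32 and Phi52 share *)
Definition bias_rate (s : R) : 'M[R]_3 :=
  (Rt s)^T *m cross_mx (a s)
    *m mx_integral (t 1%N) s (fun tau => Rt s *m (Rt tau)^T).

Definition Phi32 k : 'M[R]_3 := mx_integral (t 1%N) (t k) bias_rate.

Definition Phi34 k : 'M[R]_3 :=
  - mx_integral (t 1%N) (t k) (fun tau => (Rt tau)^T).

Definition Phi51 k : 'M[R]_3 :=
  cross_mx (P 1%N + dt k *: V 1%N - (2^-1 * dt k ^+ 2) *: g - P k)
    *m (orient_at 1)^T.

Definition Phi52 k : 'M[R]_3 :=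
  mx_integral (t 1%N) (t k) (fun theta => mx_integral (t 1%N) theta bias_rate).

Definition Phi53 k : 'M[R]_3 := (dt k)%:M.

Definition Phi54 k : 'M[R]_3 :=
  - mx_integral (t 1%N) (t k)
      (fun s => mx_integral (t 1%N) s (fun tau => (Rt tau)^T)).

Definition Phi (m k : nat) : 'M[R]_(3 + 3 + 3 + 3 + 3 + m) :=
  col6 (row6 (Phi11 k) (Phi12 k) 0         0         0    0)
       (row6 0         1%:M      0         0         0    0)
       (row6 (Phi31 k) (Phi32 k) 1%:M      (Phi34 k) 0    0)
       (row6 0         0         0         1%:M      0    0)
       (row6 (Phi51 k) (Phi52 k) (Phi53 k) (Phi54 k) 1%:M 0)
       (row6 0         0         0         0         0    1%:M).

End StateTransition.

Section PlaneFeature.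
Variables (R : realType) (L : linearization R).
Variables (d : R) (n : 'cV[R]_3).

Local Notation P := (position L).
Local Notation V := (velocity L).
Local Notation g := (gvec L).

Definition plane_cp : 'cV[R]_3 := d *: n.

Definition Hpi1 k : 'M[R]_3 :=
  (d - dotv n (P k)) *: (cross_mx n *m (orient_at L k)^T).

Definition Hpi2 k : 'M[R]_3 :=
  d^-1 *: ((d - dotv n (P k))%:M - n *m (P k)^T
           + (2 * dotv n (P k)) *: (n *m n^T)).

(* the 3 x 9 zero block is written as three 3 x 3 blocks *)
Definition meas_jacobian k : 'M[R]_(3, 3 + 3 + 3 + 3 + 3 + 3) :=
  orient_at L k *m row6 (Hpi1 k) 0 0 0 (- (n *m n^T)) (Hpi2 k).

(* The rows of the observability matrix for the steps k = 1, ..., K.  The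
   infinite matrix annihilates v iff obs_mx K does for every K. *)
Definition obs_mx (K : nat) : 'M[R]_(\sum_(k < K) 3, 3 + 3 + 3 + 3 + 3 + 3) :=
  \mxcol_(k < K) (meas_jacobian k.+1 *m Phi L 3 k.+1).

Variables (n1 n2 : 'cV[R]_3).

Definition plane_rot : 'M[R]_3 := row_mx (row_mx n1 n2) n.

Definition Ng : 'cV[R]_(3 + 3 + 3 + 3) :=
  col4 (orient_at L 1 *m g) 0 (- (cross_mx (V 1%N) *m g)) 0.

Definition N123 : 'M[R]_(3 + 3 + 3 + 3, 3) :=
  col4 (row_mx (row_mx 0 0) (orient_at L 1 *m n))
       0
       (row_mx (row_mx n1 n2) 0)
       0.

(* If n is parallel to g (a horizontal plane), the first column is a linear
   combination of the others and the rank drops to 6: then g = c n, the feature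
   rows vanish, and V_1 x g and P_1 x g lie in the span of n1 and n2. *)
Definition Npi : 'M[R]_(3 + 3 + 3 + 3 + 3 + 3, 1 + 3 + 3) :=
  col_mx (col_mx
    (row_mx (row_mx Ng 0) N123)
    (row_mx (row_mx (- (cross_mx (P 1%N) *m g)) plane_rot) 0))
    (row_mx (row_mx (- (cross_mx plane_cp *m g))
                    (n *m (delta_mx (2%:R : 'I_3) 0)^T)) 0).

End PlaneFeature.

(* Main.v *)
Require Import Defs.
From HB Require Import structures.
From mathcomp Require Import all_boot all_order all_algebra.
From mathcomp Require Import all_classical all_reals all_analysis.
From mathcomp Require Import ring.

Import Order.TTheory GRing.Theory Num.Theory.
Local Open Scope ring_scope.

(** The accelerometer and gyroscope bias rows of [Npi] vanish, so only the
    integral-free blocks of the transition matrix act on it.  For the gravity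
    column, the propagated position error collapses to [- P_k x g], whose
    component along [n] cancels against the feature error [- d (n x g)] through
    [n . (P x g) = - P . (n x g)].  For independence, crossing the orientation
    rows with [n] isolates the coefficient of the gravity column, which is
    multiplied by [n x g]; the other six coefficients are then killed by two
    copies of the invertible matrix [plane_rot]. *)

Lemma crossvC (R : realType) (a b : 'cV[R]_3) : crossv a b = - crossv b a.
Proof. by apply/matrixP => i j; rewrite !mxE; ring. Qed.

Lemma crossvv (R : realType) (a : 'cV[R]_3) : crossv a a = 0.
Proof. by apply/matrixP => i j; rewrite !mxE; ring. Qed.

Lemma cross_mx_mulC (R : realType) (a b : 'cV[R]_3) :
  cross_mx a *m b = - (cross_mx b *m a).
Proof. by rewrite !cross_mxE crossvC. Qed.

(** Row form of the antisymmetry of the scalar triple product; transposing reduces it to the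
    anticommutativity of the cross product. *)
Lemma trmx_mul_cross_mx (R : realType) (a b : 'cV[R]_3) :
  a^T *m cross_mx b = - (b^T *m cross_mx a).
Proof.
apply: trmx_inj; rewrite linearN /= !trmx_mul !trmxK !cross_mx_antisym.
by rewrite !mulNmx cross_mx_mulC.
Qed.

Lemma trmx_mul_cross_mx_self (R : realType) (a : 'cV[R]_3) :
  a^T *m cross_mx a = 0.
Proof.
apply: trmx_inj; rewrite trmx_mul trmxK cross_mx_antisym mulNmx cross_mxE.
by rewrite crossvv oppr0 trmx0.
Qed.

Lemma cross_mx_orth (R : realType) (a b : 'cV[R]_3) :
  a^T *m (cross_mx b *m a) = 0.
Proof.
by rewrite mulmxA trmx_mul_cross_mx mulNmx -mulmxA cross_mxE crossvv mulmx0 oppr0.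
Qed.

Lemma trmx_mul_dotv (R : realType) (u v : 'cV[R]_3) : u^T *m v = (dotv u v)%:M.
Proof. exact: mx11_scalar. Qed.

Lemma dotvC (R : realType) (u v : 'cV[R]_3) : dotv u v = dotv v u.
Proof. by rewrite /dotv -[u^T *m v]trmxK trmx_mul trmxK mxE. Qed.

Lemma SO3_trmxK (R : realType) (A : 'M[R]_3) q (X : 'M[R]_(3, q)) :
  is_SO3 A -> A^T *m (A *m X) = X.
Proof. by case=> /mulmx1C AtA _; rewrite mulmxA AtA mul1mx. Qed.

Lemma SO3_mulmx_eq0 (R : realType) (A : 'M[R]_3) q (X : 'M[R]_(3, q)) :
  is_SO3 A -> A *m X = 0 -> X = 0.
Proof. by move=> SO3A AX0; rewrite -(@SO3_trmxK _ _ _ X SO3A) AX0 mulmx0. Qed.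

Lemma mul_row6_col6 (R : realType) p q n1 n2 n3 n4 n5 n6
    (A1 : 'M[R]_(p, n1)) (A2 : 'M[R]_(p, n2)) (A3 : 'M[R]_(p, n3))
    (A4 : 'M[R]_(p, n4)) (A5 : 'M[R]_(p, n5)) (A6 : 'M[R]_(p, n6))
    (B1 : 'M[R]_(n1, q)) (B2 : 'M[R]_(n2, q)) (B3 : 'M[R]_(n3, q))
    (B4 : 'M[R]_(n4, q)) (B5 : 'M[R]_(n5, q)) (B6 : 'M[R]_(n6, q)) :
  row6 A1 A2 A3 A4 A5 A6 *m col6 B1 B2 B3 B4 B5 B6 =
  A1 *m B1 + A2 *m B2 + A3 *m B3 + A4 *m B4 + A5 *m B5 + A6 *m B6.
Proof. by rewrite /row6 /col6 /col4 !mul_row_col. Qed.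

(** Every column of [Npi] has this shape: the zero bias blocks meet exactly the columns of [Phi]
    that contain integrals. *)
Lemma Phi_mul_col6 (R : realType) (L : linearization R) m k q
    (X1 X3 X5 : 'M[R]_(3, q)) (X6 : 'M[R]_(m, q)) :
  Phi L m k *m col6 X1 0 X3 0 X5 X6 =
  col6 (Phi11 L k *m X1) 0 (Phi31 L k *m X1 + X3) 0
       (Phi51 L k *m X1 + elapsed L k *: X3 + X5) X6.
Proof.
rewrite /Phi {1}/col6 {1}/col4 !mul_col_mx !mul_row6_col6.
by rewrite !(mulmx0, mul0mx, mul1mx, addr0, add0r) /Phi53 mul_scalar_mx.
Qed.

(** The factor [orient_at L 1] on [X1] cancels the transpose ending [Phi11] and [Phi51], and the
    transpose in [Hpi1] cancels the leading factor of [Phi11]. Only the outer rotation survives. *)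
Lemma meas_Phi_mul_col6 (R : realType) (L : linearization R) (d : R)
    (n : 'cV[R]_3) k q (X1 X3 X5 X6 : 'M[R]_(3, q)) :
  (forall tau, is_SO3 (orient L tau)) ->
  meas_jacobian L d n k *m Phi L 3 k *m
    col6 (orient_at L 1 *m X1) 0 X3 0 X5 X6 =
  orient_at L k *m
    ((d - dotv n (position L k)) *: (cross_mx n *m X1)
     - n *m (n^T *m (cross_mx (position L 1 + elapsed L k *: velocity L 1
          - (2^-1 * elapsed L k ^+ 2) *: gvec L - position L k) *m X1
        + elapsed L k *: X3 + X5))
     + Hpi2 L d n k *m X6).
Proof.
move=> SO3; rewrite -mulmxA Phi_mul_col6 /meas_jacobian -mulmxA mul_row6_col6.
rewrite !mul0mx !addr0 /Hpi1 /Phi11 /Phi51 -scalemxAl mulNmx -!mulmxA.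
by rewrite !SO3_trmxK; do ?exact: SO3.
Qed.

(** Regroups [Npi] by columns, with [orient_at L 1] factored out, to match [meas_Phi_mul_col6]. *)
Lemma Npi_columns (R : realType) (L : linearization R) (d : R)
    (n n1 n2 : 'cV[R]_3) :
  Npi L d n n1 n2 =
  row_mx (row_mx
    (col6 (orient_at L 1 *m gvec L) 0 (- (cross_mx (velocity L 1) *m gvec L)) 0
      (- (cross_mx (position L 1) *m gvec L))
      (- (cross_mx (plane_cp d n) *m gvec L)))
    (col6 0 0 0 0 (plane_rot n n1 n2) (n *m (delta_mx (2%:R : 'I_3) 0)^T)))
    (col6 (orient_at L 1 *m row_mx (0 : 'M[R]_(3, 1 + 1)) n) 0
      (row_mx (row_mx n1 n2) 0) 0 0 0).
Proof.
have colE m1 m2 p1 p2 (A : 'M[R]_(m1, p1)) (B : 'M[R]_(m1, p2))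
    (C : 'M[R]_(m2, p1)) (D : 'M[R]_(m2, p2)) :
  col_mx (row_mx A B) (row_mx C D) = row_mx (col_mx A C) (col_mx B D).
  by rewrite -block_mxEh.
have -> : orient_at L 1 *m row_mx (0 : 'M[R]_(3, 1 + 1)) n =
    row_mx (0 : 'M[R]_(3, 1 + 1)) (orient_at L 1 *m n).
  by rewrite (mul_mx_row (orient_at L 1) 0 n) mulmx0.
by rewrite /Npi /col6 !colE /Ng /N123 /col4 !col_mx0 !row_mx0.
Qed.

Lemma obs_gravity_column (R : realType) (L : linearization R) (d : R)
    (n : 'cV[R]_3) k :
  (forall tau, is_SO3 (orient L tau)) -> d != 0 ->
  meas_jacobian L d n k *m Phi L 3 k *m
    col6 (orient_at L 1 *m gvec L) 0 (- (cross_mx (velocity L 1) *m gvec L)) 0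
      (- (cross_mx (position L 1) *m gvec L))
      (- (cross_mx (plane_cp d n) *m gvec L)) = 0.
Proof.
move=> SO3 d_neq0; rewrite meas_Phi_mul_col6 //.
set g := gvec L; set P := position L; set V := velocity L; clearbody g.
(* The [P 1] and [V 1] terms cancel against the position and velocity blocks, and the quadratic term
   dies because [g] is parallel to itself. *)
have posE : cross_mx (P 1 + elapsed L k *: V 1%N
    - (2^-1 * elapsed L k ^+ 2) *: g - P k) *m g
    + elapsed L k *: - (cross_mx (V 1%N) *m g) - cross_mx (P 1%N) *m g
    = - (cross_mx (P k) *m g).
  rewrite ![cross_mx _ *m g]cross_mx_mulC !mulmxDr !mulmxN -!scalemxAr.
  rewrite [cross_mx g *m g]cross_mxE crossvv scaler0.
  by apply/matrixP=> i j; rewrite !mxE; ring.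
(* The factor [d] of [plane_cp] cancels the [d^-1] of [Hpi2]; the [n *m n^T] term dies since [n] is
   orthogonal to its cross product with [g]. *)
have featE : Hpi2 L d n k *m - (cross_mx (plane_cp d n) *m g) =
    - ((d - dotv n (P k)) *: (cross_mx n *m g)
       - n *m ((P k)^T *m cross_mx n *m g)).
  have -> : cross_mx (plane_cp d n) *m g = d *: (cross_mx n *m g).
    by rewrite /plane_cp cross_mx_mulC -scalemxAr -scalerN -cross_mx_mulC.
  rewrite mulmxN /Hpi2 -scalemxAl -scalemxAr scalerA mulVf // scale1r.
  rewrite !mulmxDl mul_scalar_mx mulNmx -scalemxAl -/P -!mulmxA.
  by rewrite [n^T *m _]mulmxA trmx_mul_cross_mx_self mul0mx mulmx0 scaler0 addr0.
rewrite posE featE mulmxN [n^T *m _]mulmxA trmx_mul_cross_mx mulNmx opprK.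
by rewrite subrr mulmx0.
Qed.

Lemma trmx_mul_plane_rot (R : realType) (n n1 n2 : 'cV[R]_3) :
  dotv n n = 1 -> dotv n1 n = 0 -> dotv n2 n = 0 ->
  n^T *m plane_rot n n1 n2 = (delta_mx (2%:R : 'I_3) 0)^T.
Proof.
move=> nn n1n n2n.
have -> : n^T *m plane_rot n n1 n2 = row_mx (n^T *m row_mx n1 n2) (n^T *m n).
  exact: (mul_mx_row n^T (row_mx n1 n2) n).
rewrite mul_mx_row !trmx_mul_dotv nn [dotv n n1]dotvC [dotv n n2]dotvC n1n n2n.
apply/matrixP=> i j; rewrite (ord1 i) trmx_delta !mxE.
(* Of the column blocks [1 + 1 + 1], the last one is index 2, where the entry is 1. *)
case: splitP => l /= jl; last by rewrite mxE -!val_eqE /= jl (ord1 l).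
rewrite mxE; case: splitP => ? /= ll.
  by rewrite !mxE mul0rn -val_eqE /= jl ll ord1.
by rewrite !mxE mul0rn -val_eqE /= jl ll ord1.
Qed.

(** Writing [p] for [dotv n (position L k)], the coefficient of [n] is
    [d^-1 * ((d - p) - p + 2 * p) = 1]. *)
Lemma Hpi2_normal (R : realType) (L : linearization R) (d : R) (n : 'cV[R]_3) k :
  d != 0 -> dotv n n = 1 -> Hpi2 L d n k *m n = n.
Proof.
move=> d_neq0 nn; rewrite /Hpi2 -scalemxAl !mulmxDl mul_scalar_mx mulNmx.
rewrite -scalemxAl -!mulmxA !trmx_mul_dotv nn [dotv _ n]dotvC !mul_mx_scalar.
rewrite scale1r -!scaleNr -!scalerDl scalerA; set c := _ * _.
by have -> : c = 1; [rewrite /c; field | rewrite scale1r].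
Qed.

(** A translation of the sensor along [n] is compensated by an equal shift of the plane;
    translations along [n1] and [n2] leave the plane fixed. *)
Lemma obs_plane_rot_columns (R : realType) (L : linearization R) (d : R)
    (n n1 n2 : 'cV[R]_3) k :
  (forall tau, is_SO3 (orient L tau)) -> d != 0 ->
  dotv n n = 1 -> dotv n1 n = 0 -> dotv n2 n = 0 ->
  meas_jacobian L d n k *m Phi L 3 k *m
    col6 0 0 0 0 (plane_rot n n1 n2) (n *m (delta_mx (2%:R : 'I_3) 0)^T) = 0.
Proof.
move=> SO3 d_neq0 nn n1n n2n.
have := @meas_Phi_mul_col6 _ L d n k _ 0 0 (plane_rot n n1 n2)
  (n *m (delta_mx (2%:R : 'I_3) 0)^T) SO3.
rewrite mulmx0 => ->; rewrite !mulmx0 !(scaler0, add0r, mulmx0).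
by rewrite trmx_mul_plane_rot // [Hpi2 _ _ _ _ *m _]mulmxA Hpi2_normal // addNr mulmx0.
Qed.

(** Rotation about [n] and velocity within the plane move the sensor only orthogonally to [n], and
    the rotation itself fixes the measured normal. *)
Lemma obs_N123_columns (R : realType) (L : linearization R) (d : R)
    (n n1 n2 : 'cV[R]_3) k :
  (forall tau, is_SO3 (orient L tau)) -> dotv n1 n = 0 -> dotv n2 n = 0 ->
  meas_jacobian L d n k *m Phi L 3 k *m
    col6 (orient_at L 1 *m row_mx (0 : 'M[R]_(3, 1 + 1)) n) 0
      (row_mx (row_mx n1 n2) 0) 0 0 0 = 0.
Proof.
move=> SO3 n1n n2n; rewrite meas_Phi_mul_col6 //.
have mulE (A : 'M[R]_3) : A *m row_mx (0 : 'M[R]_(3, 1 + 1)) n =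
    row_mx (0 : 'M[R]_(3, 1 + 1)) (A *m n).
  by rewrite (mul_mx_row A 0 n) mulmx0.
rewrite !mulE cross_mxE crossvv !row_mx0 !(mulmx0, addr0) mulmxDr mul_mx_row.
rewrite cross_mx_orth -scalemxAr !mul_mx_row !mulmx0 !trmx_mul_dotv.
rewrite [dotv n n1]dotvC [dotv n n2]dotvC n1n n2n.
by rewrite !(raddf0, row_mx0, scaler0, mulmx0, addr0, oppr0).
Qed.

Theorem lemma4p4 (R : realType) (L : linearization R)
    (step_time_mono : forall i j : nat,
       (1 <= i)%N -> (i <= j)%N -> step_time L i <= step_time L j)
    (orient_SO3 : forall tau : R, is_SO3 (orient L tau))
    (grav_gt0 : 0 < grav L)
    (d : R) (n n1 n2 : 'cV[R]_3)
    (d_neq0 : d != 0)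
    (n_unit : dotv n n = 1) (n1_unit : dotv n1 n1 = 1) (n2_unit : dotv n2 n2 = 1)
    (n1_n2 : dotv n1 n2 = 0) (n1_n : dotv n1 n = 0) (n2_n : dotv n2 n = 0)
    (plane_rot_SO3 : is_SO3 (plane_rot n n1 n2)) :
  (forall K : nat, obs_mx L d n K *m Npi L d n n1 n2 = 0) /\
  (crossv n (gvec L) != 0 -> row_free (Npi L d n n1 n2)^T).
Proof.
split=> [K|ng_neq0].
  rewrite /obs_mx mxcol_mul -[RHS]mxcol0; apply: eq_mxcol => k.
  rewrite Npi_columns !(mul_mx_row (_ *m _)) obs_gravity_column //.
  by rewrite obs_plane_rot_columns // obs_N123_columns // !row_mx0.
apply: inj_row_free => v /(congr1 trmx).
rewrite trmx_mul trmxK trmx0 => Nv0; apply: trmx_inj; rewrite trmx0.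
(* Split the coefficients into [a] for gravity, [b] for the [plane_rot] columns and [c] for the
   [N123] columns. *)
move: (v^T) Nv0 => {v} w; rewrite -(vsubmxK w) -(vsubmxK (usubmx w)).
move: (usubmx (usubmx w)) (dsubmx (usubmx w)) (dsubmx w) => {w} a b c.
rewrite Npi_columns !mul_row_col /col6 /col4 !mul_col_mx !add_col_mx.
move=> /eqP; rewrite !col_mx_eq0 !(mul0mx, addr0) -!mulmxA -!mulmxDr.
case/andP=> [/andP[/andP[/andP[/andP[/eqP theta0 _] /eqP v0] _] /eqP p0] _].
have {}theta0 := SO3_mulmx_eq0 _ _ _ _ (orient_SO3 _) theta0.
have a0 : a = 0.
  have /(congr1 (mulmx (cross_mx n))) := theta0.
  rewrite mulmx0 mulmxDr !mulmxA.
  rewrite (mul_mx_row (cross_mx n) (0 : 'M[R]_(3, 1 + 1)) n) mulmx0.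
  rewrite !cross_mxE crossvv row_mx0 mul0mx addr0 [a]mx11_scalar mul_mx_scalar.
  by move=> /eqP; rewrite scaler_eq0 (negPf ng_neq0) orbF => /eqP ->; rewrite raddf0.
move: theta0 v0 p0; rewrite a0 !mulmx0 !add0r => nc0 n12c0.
move=> /(SO3_mulmx_eq0 _ _ _ _ plane_rot_SO3) ->.
have -> : c = 0.
  apply: (SO3_mulmx_eq0 _ _ _ _ plane_rot_SO3).
  (* The orientation and velocity rows carry complementary columns of [plane_rot], so adding their
     equations gives [plane_rot *m c = 0]. *)
  have -> : plane_rot n n1 n2 = row_mx (0 : 'M[R]_(3, 1 + 1)) n + row_mx (row_mx n1 n2) 0.
    by rewrite /plane_rot add_row_mx add0r addr0.
  by rewrite mulmxDl nc0 n12c0 addr0.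
by rewrite !col_mx0.
Qed.
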